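(* Let $\mathcal{H}$ be a real Hilbert space and $f,g\in\Gamma_0(\mathcal{H})$ such that $\inf_{x\in\mathcal{H}}\big(f(x)+g(x)\big)=\sup_{\nu\in\mathcal{H}}\big(-f^*(\nu)-g^*(-\nu)\big)$. Define $F(x,\nu)=f(x)+f^*(\nu)$, $G(x,\nu)=g(x)+g^*(-\nu)$ and the nonempty closed convex cones $$\mathcal{F}=\{(x,\nu,\tau,\kappa)\in\mathcal{H}\times\mathcal{H}\times\mathbb{R}^2\mid\widetilde{F}(x,\nu,\tau)\le-\kappa\},\qquad \mathcal{G}=\{(x,\nu,\tau,\kappa)\in\mathcal{H}\times\mathcal{H}\times\mathbb{R}^2\mid\widetilde{G}(x,\nu,\tau)\le\kappa\}.$$ (i) Let $p\in\mathcal{H}$, $r\in\mathbb{R}$, and let $\hat x$ be either $P_{\operatorname{rec}(\overline{\operatorname{dom}}f)}(p)$ or $P_{\overline{\operatorname{dom}}(\operatorname{rec}f)}(p)$ (either choice). Then $P_{\mathcal{F}}(p,p,r,r)=(x,p-x,\tau,r-\tau)$, where: if $(\operatorname{rec}f)(\hat x)+(\operatorname{rec}f^* )(p-\hat x)\le-r$, then $(x,\tau)=(\hat x,0)$; otherwise, $(x,\tau)$ is the unique solution in $\mathcal{H}\times\left]0,+\infty\right[$ of the system $$x=\tau\operatorname{Prox}_f(p/\tau),\qquad \tau-r=\langle x\mid p-x\rangle/\tau ,$$ which exists. (ii) Let $\tilde p\in\mathcal{H}$, $\tilde r\in\mathbb{R}$, and let $\bar x$ be either $P_{\operatorname{rec}(\overline{\operatorname{dom}}g)}(\tilde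 p)$ or $P_{\overline{\operatorname{dom}}(\operatorname{rec}g)}(\tilde p)$ (either choice). Then $P_{\mathcal{G}}(\tilde p,-\tilde p,\tilde r,-\tilde r)=(\tilde x,\tilde x-\tilde p,\tilde\tau,\tilde\tau-\tilde r)$, where: if $(\operatorname{rec}g)(\bar x)+(\operatorname{rec}g^* )(\tilde p-\bar x)\le-\tilde r$, then $(\tilde x,\tilde\tau)=(\bar x,0)$; otherwise, $(\tilde x,\tilde\tau)$ is the unique solution in $\mathcal{H}\times\left]0,+\infty\right[$ of the system $$\tilde x=\tilde\tau\operatorname{Prox}_g(\tilde p/\tilde\tau),\qquad \tilde\tau-\tilde r=\langle\tilde x\mid\tilde p-\tilde x\rangle/\tilde\tau ,$$ which exists.
   Context: $\Gamma_0(\mathcal{H})$ is the set of proper lower semicontinuous convex functions $\mathcal{H}\to\left]-\infty,+\infty\right]$. For $h\in\Gamma_0(\mathcal{H})$: $\operatorname{dom}h=\{x\mid h(x)<+\infty\}$, with closure $\overline{\operatorname{dom}}\,h$; $h^*(u)=\sup_{x}(\langle x\mid u\rangle-h(x))$; $(\operatorname{rec}h)(y)=\sup_{x\in\operatorname{dom}h}(h(x+y)-h(x))$ is the recession function; $\operatorname{Prox}_h(x)=\operatorname{argmin}_y\big(h(y)+\tfrac12\|y-x\|^2\big)$; the perspective function is $\widetilde{h}(x,\tau)=\tau h(x/\tau)$ if $\tau>0$, $(\operatorname{rec}h)(x)$ if $\tau=0$, $+\infty$ if $\tau<0$. For $F,G\in\Gamma_0(\mathcal{H}\times\mathcal{H})$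 the perspectives are functions of $((x,\nu),\tau)$, written $(x,\nu,\tau)$. For a nonempty closed convex set $C$, $\operatorname{rec}C=\{x\mid x+y\in C\ \text{for all }y\in C\}$ is its recession cone and $P_C$ the metric projection onto it. $\overline{\operatorname{dom}}(\operatorname{rec}f)$ is the closure of the domain of the function $\operatorname{rec}f$, while $\operatorname{rec}(\overline{\operatorname{dom}}f)$ is the recession cone of the closure of $\operatorname{dom}f$. Product spaces carry the sum inner product. *)

(* Defs.v *)
From HB Require Import structures.
From mathcomp Require Import all_boot all_order all_algebra.
From mathcomp Require Import all_classical all_reals all_analysis.

Set Implicit Arguments.
Unset Strict Implicit.
Unset Printing Implicit Defensive.

Import Order.TTheory GRing.Theory Num.Theory.
Import numFieldNormedType.Exports.

Local Open Scope classical_set_scope.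
Local Open Scope ring_scope.

HB.mixin Record Lmodule_hasInner (R : realType) V & GRing.Lmodule R V := {
  dotp : {dot V for (idfun : R -> R)}
}.

#[short(type="innerType")]
HB.structure Definition Inner (R : realType) :=
  {V of GRing.Lmodule R V & Lmodule_hasInner R V}.

Definition inner (R : realType) (V : innerType R) (x y : V) : R :=
  (dotp : {dot V for (idfun : R -> R)}) x y.

Definition inorm (R : realType) (V : innerType R) (x : V) : R :=
  Num.sqrt (inner x x).

(* Real Hilbert spaces: the norm that carries the (complete) topology is the
   one induced by the inner product. *)
HB.mixin Record NormedModule_isHilbert (R : realType) V
    & NormedModule R V & Inner R V := {
  normr_inner : forall x : V, `|x| = inorm x
}.

#[short(type="hilbertType")]
HB.structure Definition Hilbert (R : realType) :=
  {V of CompleteNormedModule R V & Inner R V & NormedModule_isHilbert R V}.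

(* Instances for R (with inner product x * y) and for V * W (with the sum of
   the inner products). *)
Section inner_scalar.
Context (R : realType).

Let dot (x y : R^o) : R := x * y.

Let dot_additivel (v : R^o) : zmod_morphism (dot ^~ v).
Proof. by move=> x y; rewrite /dot mulrBl. Qed.

Let dot_additiver (u : R^o) : zmod_morphism (dot u).
Proof. by move=> x y; rewrite /dot mulrBr. Qed.

Let dot_scalablel (v : R^o) : scalable_for *%R (dot ^~ v).
Proof. by move=> a x; rewrite /dot/= [in LHS]/GRing.scale/= mulrA. Qed.

Let dot_scalabler (u : R^o) : scalable_for ((idfun : R -> R) \; *%R) (dot u).
Proof. by move=> a x; rewrite /dot/= [in LHS]/GRing.scale/= mulrCA. Qed.

HB.instance Definition _ := isBilinear.Build R R^o R^o R
  *%R ((idfun : R -> R) \; *%R) dot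
  dot_additivel dot_additiver dot_scalablel dot_scalabler.

Let dot_sym (x y : R^o) : dot x y = (-1) ^+ false * (idfun : R -> R) (dot y x).
Proof. by rewrite expr0 mul1r /= /dot mulrC. Qed.

HB.instance Definition _ :=
  isHermitianSesquilinear.Build R R^o false idfun dot dot_sym.

Let dot_gt0 (x : R^o) : x != 0 -> 0 < dot x x.
Proof. by move=> x0; rewrite /dot -expr2 exprn_even_gt0. Qed.

HB.instance Definition _ := isDotProduct.Build R R^o dot dot_gt0.

HB.instance Definition _ := Lmodule_hasInner.Build R R^o dot.

End inner_scalar.

HB.instance Definition _ (R : realType) := Inner.copy R R^o.

Section inner_prod.
Context (R : realType) (V W : innerType R).
Implicit Types x y : V * W.

Let dot x y : R := inner x.1 y.1 + inner x.2 y.2.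

Let dot_additivel v : zmod_morphism (dot ^~ v).
Proof. by move=> x y; rewrite /dot /inner/= !linearBl/= addrACA opprD. Qed.

Let dot_additiver u : zmod_morphism (dot u).
Proof. by move=> x y; rewrite /dot /inner/= !linearBr/= addrACA opprD. Qed.

Let dot_scalablel v : scalable_for *%R (dot ^~ v).
Proof. by move=> a x; rewrite /dot /inner/= !linearZl/= mulrDr. Qed.

Let dot_scalabler u : scalable_for ((idfun : R -> R) \; *%R) (dot u).
Proof. by move=> a x; rewrite /dot /inner/= !linearZr/= mulrDr. Qed.

HB.instance Definition _ := isBilinear.Build R (V * W)%type (V * W)%type R
  *%R ((idfun : R -> R) \; *%R) dot
  dot_additivel dot_additiver dot_scalablel dot_scalabler.

Let dot_sym x y : dot x y = (-1) ^+ false * (idfun : R -> R) (dot y x).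
Proof.
rewrite expr0 mul1r /= /dot /inner.
by congr (_ + _); rewrite hermitian_subproof expr0 mul1r.
Qed.

HB.instance Definition _ :=
  isHermitianSesquilinear.Build R (V * W)%type false idfun dot dot_sym.

Let inner_ge0 (U : innerType R) (u : U) : 0 <= inner u u.
Proof.
have [->|u0] := eqVneq u 0; first by rewrite /inner linear0l.
exact/ltW/neq0_dnorm_gt0.
Qed.

Let dot_gt0 x : x != 0 -> 0 < dot x x.
Proof.
case: x => a b; rewrite /dot/= -pair_eqE/= negb_and => /orP[a0|b0].
  by rewrite ltr_wpDr//; exact: neq0_dnorm_gt0.
by rewrite ltr_wpDl//; exact: neq0_dnorm_gt0.
Qed.

HB.instance Definition _ :=
  isDotProduct.Build R (V * W)%type dot dot_gt0.

HB.instance Definition _ := Lmodule_hasInner.Build R (V * W)%type dot.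

End inner_prod.

Section convex_analysis.
Context (R : realType).
Local Open Scope ereal_scope.

Definition proper_efun (T : Type) (h : T -> \bar R) : Prop :=
  (forall x, -oo < h x) /\ (exists x, h x < +oo).

Definition convex_efun (V : lmodType R) (h : V -> \bar R) : Prop :=
  forall (x y : V) (t : R), (0 < t < 1)%R ->
    h (t *: x + (1 - t) *: y)%R <= t%:E * h x + (1 - t)%:E * h y.

Definition Gamma0 (V : normedModType R) (h : V -> \bar R) : Prop :=
  [/\ proper_efun h, lower_semicontinuous h & convex_efun h].

Definition edom (T : Type) (h : T -> \bar R) : set T := [set x | h x < +oo].

Definition fenchel_conj (V : innerType R) (h : V -> \bar R) (u : V) : \bar R :=
  ereal_sup (range (fun x => (inner x u)%:E - h x)).

Definition recession (V : lmodType R) (h : V -> \bar R) (y : V) : \bar R :=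
  ereal_sup [set h (x + y)%R - h x | x in edom h].

Definition perspective (V : lmodType R) (h : V -> \bar R) (z : V * R)
  : \bar R :=
  if (0 < z.2)%R then z.2%:E * h (z.2^-1 *: z.1)%R
  else if z.2 == 0%R then recession h z.1
  else +oo.

Definition argmin (T : Type) (A : set T) (h : T -> \bar R) : set T :=
  [set x | A x /\ forall y, A y -> h x <= h y].

(* Prox and metric_proj are total functions: they select an element of the
   argmin, which is a singleton when h is in Gamma0 and V is a Hilbert space
   (resp. when C is a nonempty closed convex subset of a Hilbert space). *)
Definition Prox (V : hilbertType R) (h : V -> \bar R) (x : V) : V :=
  xget 0%R (argmin setT (fun y => h y + (2^-1 * `|y - x| ^+ 2)%:E)).

(* The distance is that of the inner product: on a product V * W, which carries
   the sum inner product, the library's norm `|_| is the maximum norm. *)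
Definition metric_proj (V : innerType R) (C : set V) (p : V) : V :=
  xget 0%R (argmin C (fun q => (inorm (p - q))%:E)).

Definition recession_cone (V : lmodType R) (C : set V) : set V :=
  [set x | forall y, C y -> C (x + y)%R].

Definition is_cone (V : lmodType R) (C : set V) : Prop :=
  forall (a : R) x, (0 < a)%R -> C x -> C (a *: x)%R.

End convex_analysis.

(* Main.v *)
Require Import Defs.
From HB Require Import structures.
From mathcomp Require Import all_boot all_order all_algebra.
From mathcomp Require Import all_classical all_reals all_analysis.
From mathcomp Require Import ring lra.

Set Implicit Arguments.
Unset Strict Implicit.
Unset Printing Implicit Defensive.

Import Order.TTheory GRing.Theory Num.Theory.
Import numFieldNormedType.Exports.

Local Open Scope classical_set_scope.
Local Open Scope ring_scope.

(** Fenchel-Moreau makes F(x, v) = f(x) + f^*(v) its own conjugate for the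
pairing ((x, v), (x', v')) |-> <x, v'> + <v, x'>. For the cone this means that the
swap S(x, v, t, k) = (v, x, k, t) maps it onto its polar cone; hence it is closed
and convex, and q belongs to it and satisfies <Sq, q> = 0 exactly when q is the
projection of q + Sq. Since S fixes (p, p, r, r), the Moreau decomposition of this
point is q + Sq, that is, q = (x, p - x, t, r - t). When t > 0, membership and
orthogonality of q amount to equality in the Fenchel-Young inequality for x / t
and (p - x) / t, which is the system. When t = 0 they say that
(rec f)(x) + (rec f^* )(p - x) <= - r and that x and p - x are orthogonal, which
identifies x with both projections of p. The cone of G is the image of the cone
attached to g under (x, v, t, k) |-> (x, - v, t, - k). *)

(** * Inner product spaces: strongly convex minimization and metric projections *)

Section inner_theory.
Context (R : realType) (V : innerType R).
Implicit Types (x y z : V) (a : R).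

Lemma innerC x y : inner x y = inner y x.
Proof. by rewrite /inner hermitian_subproof expr0 mul1r. Qed.

Lemma innerDl x y z : inner (x + y) z = inner x z + inner y z.
Proof. by rewrite /inner linearDl. Qed.

Lemma innerDr x y z : inner x (y + z) = inner x y + inner x z.
Proof. by rewrite /inner linearDr. Qed.

Lemma innerNl x y : inner (- x) y = - inner x y.
Proof. by rewrite /inner linearNl. Qed.

Lemma innerNr x y : inner x (- y) = - inner x y.
Proof. by rewrite /inner linearNr. Qed.

Lemma innerBl x y z : inner (x - y) z = inner x z - inner y z.
Proof. by rewrite innerDl innerNl. Qed.

Lemma innerBr x y z : inner x (y - z) = inner x y - inner x z.
Proof. by rewrite innerDr innerNr. Qed.

Lemma innerZl a x y : inner (a *: x) y = a * inner x y.
Proof. by rewrite /inner linearZl. Qed.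

Lemma innerZr a x y : inner x (a *: y) = a * inner x y.
Proof. by rewrite /inner linearZr. Qed.

Lemma inner0l x : inner 0 x = 0.
Proof. by rewrite /inner linear0l. Qed.

Lemma inner0r x : inner x 0 = 0.
Proof. by rewrite innerC inner0l. Qed.

Lemma inner_ge0 x : 0 <= inner x x.
Proof.
have [->|x0] := eqVneq x 0; first by rewrite inner0l.
exact/ltW/neq0_dnorm_gt0.
Qed.

Lemma inner_eq0 x : inner x x <= 0 -> x = 0.
Proof.
move=> h; apply/eqP/negP => /negP x0.
have : 0 < inner x x by exact: neq0_dnorm_gt0.
by rewrite ltNge h.
Qed.

Definition innerE := (innerDl, innerDr, innerNl, innerNr, innerZl, innerZr).

Lemma inner_young x y a : 0 < a ->
  2 * inner x y <= a * inner x x + a^-1 * inner y y.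
Proof.
move=> a0; have := inner_ge0 (a *: x - y).
rewrite !innerE (innerC y x) => h.
by rewrite -(ler_pM2l a0) mulrDr mulVKf ?gt_eqF//; lra.
Qed.

(** Continuity of the linear form at 0, phrased with squared distances because an [innerType]
    carries no topology. It follows from [inner_young] applied to x and to - x. *)
Lemma inner_small y e : 0 < e ->
  exists2 d, 0 < d & forall x, inner x x < d -> `|inner x y| < e.
Proof.
(* This Young weight makes k^-1 <y, y> smaller than e; the added 1 keeps k positive when y = 0. *)
move=> e0; set k := (inner y y + 1) / e.
have k0 : 0 < k by rewrite divr_gt0// ltr_wpDl// inner_ge0.
have ki : 0 < k^-1 by rewrite invr_gt0.
exists (e / k); first by rewrite divr_gt0.
move=> x xe.
have h1 := inner_young x y k0; have h2 := inner_young (- x) y k0.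
rewrite !innerE in h2.
have h3 : k * inner x x < e by rewrite mulrC -ltr_pdivlMr.
have h4 : k^-1 * inner y y < e.
  have y0 := inner_ge0 y.
  rewrite mulrC ltr_pdivrMr // /k mulrCA divff ?gt_eqF// mulr1; lra.
rewrite ltr_norml; apply/andP; split; lra.
Qed.

Lemma inner_midpoint x y z :
  inner (2^-1 *: (x + y) - z) (2^-1 *: (x + y) - z) =
  2^-1 * inner (x - z) (x - z) + 2^-1 * inner (y - z) (y - z)
  - 4^-1 * inner (x - y) (x - y).
Proof.
rewrite !innerE (innerC z x) (innerC z y) (innerC y x); lra.
Qed.

Lemma inner_sub_expand x y z :
  inner (x - z) (x - z) =
  inner (y - z) (y - z) + 2 * inner (x - y) (y - z) + inner (x - y) (x - y).
Proof.
rewrite !innerE (innerC z x) (innerC z y) (innerC y x); ring.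
Qed.

(** Completeness for the distance of the inner product. It is separate from the library's
    completeness because a product carries the maximum norm. *)
Definition inner_complete :=
  forall u : nat -> V,
  (forall e, 0 < e -> exists N, forall i j, (N <= i)%N -> (N <= j)%N ->
    inner (u i - u j) (u i - u j) < e) ->
  exists l, forall e, 0 < e -> exists N, forall n, (N <= n)%N ->
    inner (u n - l) (u n - l) < e.

(** The value of phi at a midpoint is at least the infimum, so the midpoint inequality forces a
    minimizing sequence to be Cauchy. The last hypothesis bundles completeness, closedness and lower
    semicontinuity, so that the lemma serves both projections and proximal points. *)
Lemma strongly_convex_min (C : set V) (phi : V -> R) (c m : R) :
  0 < c -> C !=set0 ->
  (forall x y, C x -> C y -> C (2^-1 *: (x + y)) /\
    phi (2^-1 *: (x + y)) <=
      2^-1 * phi x + 2^-1 * phi y - c * inner (x - y) (x - y)) ->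
  (forall x, C x -> m <= phi x) ->
  (forall (u : nat -> V) (M : R), (forall n, C (u n)) ->
    (forall e, 0 < e -> exists N, forall i j, (N <= i)%N -> (N <= j)%N ->
      inner (u i - u j) (u i - u j) < e) ->
    (forall e, 0 < e -> exists N, forall n, (N <= n)%N -> phi (u n) < M + e) ->
    exists2 l, C l & phi l <= M) ->
  exists2 l, C l & forall x, C x -> phi l <= phi x.
Proof.
move=> c0 [x0 Cx0] mid lb complete.
set A := phi @` C.
have Ainf : has_inf A.
  split; first by exists (phi x0), x0.
  by exists m => _ [x Cx <-]; exact: lb.
have infle x : C x -> inf A <= phi x.
  by move=> Cx; apply: (ge_inf (proj2 Ainf)); exists x.
have ex n : exists x, C x /\ phi x < inf A + n.+1%:R^-1.
  have [|_ [x Cx <-] h] := @inf_adherent _ A n.+1%:R^-1 _ Ainf.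
    by rewrite invr_gt0 ltr0n.
  by exists x.
have [u hu] := choice ex.
have near e : 0 < e -> exists N, forall n, (N <= n)%N -> phi (u n) < inf A + e.
  move=> e0; exists (Num.bound e^-1) => n Nn.
  apply: lt_trans (proj2 (hu n)) _; rewrite ltrD2l.
  rewrite -[ltRHS]invrK ltf_pV2 ?posrE ?invr_gt0 ?ltr0n//.
  apply: lt_trans (archi_boundP (ltW _)) _; rewrite ?invr_gt0// ltr_nat.
  by rewrite ltnS.
case: (complete u (inf A)) => //.
- by move=> n; case: (hu n).
- move=> e e0; have [N hN] := near (c * e) (mulr_gt0 c0 e0).
  exists N => i j /hN hi /hN hj.
  have [Cm hm] := mid _ _ (proj1 (hu i)) (proj1 (hu j)).
  have := infle _ Cm => hinf.
  have : c * inner (u i - u j) (u i - u j) < c * e by lra.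
  by rewrite ltr_pM2l.
- by move=> l Cl hl; exists l => // x Cx; exact: le_trans hl (infle _ Cx).
Qed.

Definition is_metric_proj (C : set V) (p q : V) :=
  C q /\ forall z, C z -> inner (p - q) (z - q) <= 0.

Lemma inorm_le x y : inner x x <= inner y y -> inorm x <= inorm y.
Proof. by move=> h; rewrite /inorm ler_sqrt// inner_ge0. Qed.

(** The variational inequality gives |y - p|^2 >= |q - p|^2 + |y - q|^2 for y in C, so q is the only
    minimizer and [xget] must select it. *)
Lemma metric_projE (C : set V) (p q : V) :
  is_metric_proj C p q -> metric_proj C p = q.
Proof.
move=> [Cq hq]; rewrite /metric_proj.
case: xgetP => [x -> {x}|].
  set x := xget _ _ => -[Cx /(_ _ Cq)]; rewrite lee_fin.
  rewrite /inorm ler_sqrt ?inner_ge0// => h.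
  apply/eqP; rewrite -subr_eq0; apply/eqP/inner_eq0.
  have := hq _ Cx; have := inner_sub_expand x q p.
  rewrite -[p - x]opprB -[p - q]opprB !innerNl !innerNr !opprK in h *.
  rewrite (innerC (q - p)); lra.
move=> /(_ q) []; split=> // y Cy; rewrite lee_fin; apply: inorm_le.
have := hq _ Cy; have := inner_sub_expand y q p; have := inner_ge0 (y - q).
rewrite -[p - y]opprB -[p - q]opprB !innerNl !innerNr !opprK.
rewrite (innerC (q - p)); lra.
Qed.

Lemma is_metric_proj_unique (C : set V) (p q q' : V) :
  is_metric_proj C p q -> is_metric_proj C p q' -> q = q'.
Proof. by move=> /metric_projE <- /metric_projE. Qed.

(** The ray through q stays in C, so t |-> |p - t q|^2 on t > 0 is minimal at t = 1 and its
    derivative vanishes there. If the distance has no minimizer, q is the default value 0 and the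
    claim is trivial. *)
Lemma metric_proj_scale (C : set V) (p : V) (q := metric_proj C p) :
  (forall t, 0 < t -> C q -> C (t *: q)) -> inner q (p - q) = 0.
Proof.
rewrite /q /metric_proj; case: xgetP => [x -> {q x}|_ _]; last first.
  by rewrite inner0l.
set q := xget _ _ => -[Cq hq] hcone.
have hmin t : 0 < t -> 0 <= (t - 1) * ((t - 1) * inner q q - 2 * inner q (p - q)).
  move=> /hcone /(_ Cq) /hq; rewrite lee_fin /inorm ler_sqrt ?inner_ge0//.
  rewrite !innerE (innerC q p); lra.
set b := inner q (p - q) in hmin *; set a := inner q q in hmin.
have a0 : 0 <= a by exact: inner_ge0.
apply/eqP/negP => /negP; rewrite neq_lt => /orP[] b0.
  (* The cap 1/2 keeps the factor positive; the other bound makes the quadratic term smaller than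
     the linear one, so that the distance would decrease. *)
  have := hmin (1 - (Num.min (2^-1) ((- b) / (a + 1)))).
  set s := Num.min _ _.
  have s0 : 0 < s by rewrite lt_min invr_gt0 ltr0n/= divr_gt0; lra.
  have s1 : s <= 2^-1 by rewrite ge_min lexx.
  have s2 : s * (a + 1) <= - b.
    by rewrite -ler_pdivlMr ?ge_min ?lexx ?orbT//; lra.
  move=> /(_ ltac:(lra)); rewrite leNgt => /negP; apply.
  have -> : (1 - s - 1) * ((1 - s - 1) * a - 2 * b) = s * (s * a + 2 * b) by ring.
  by rewrite pmulr_rlt0//; lra.
set s := b / (a + 1).
have s0 : 0 < s by rewrite divr_gt0//; lra.
have s2 : s * (a + 1) = b by rewrite /s divfK//; lra.
have := hmin (1 + s) ltac:(lra); rewrite leNgt => /negP; apply.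
have -> : (1 + s - 1) * ((1 + s - 1) * a - 2 * b) = s * (s * a - 2 * b) by ring.
by rewrite pmulr_rlt0//; lra.
Qed.

(** The squared distance to p is strongly convex, hence has a minimizer q on C; if the variational
    inequality failed at z, a step from q towards z would come closer to p. *)
Lemma metric_proj_exists (C : set V) (p : V) :
  inner_complete -> C !=set0 ->
  (forall x y t, 0 <= t <= 1 -> C x -> C y -> C (t *: x + (1 - t) *: y)) ->
  (forall l, (forall e, 0 < e -> exists2 x, C x & inner (x - l) (x - l) < e) -> C l) ->
  exists q, is_metric_proj C p q.
Proof.
move=> Vc C0 Cconv Ccl.
have [|||||q Cq hq] := @strongly_convex_min C (fun z => inner (z - p) (z - p)) 4^-1 0.
- by rewrite invr_gt0 ltr0n.
- by [].
- move=> x y Cx Cy; rewrite inner_midpoint; split => //.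
  rewrite scalerDr; have -> : 2^-1 = 1 - 2^-1 :> R by lra.
  rewrite {1}(_ : 1 - 2^-1 = 2^-1); last lra.
  by apply: Cconv => //; apply/andP; split; lra.
- by move=> x _; exact: inner_ge0.
- move=> u M uC /Vc[l ul] hM; exists l.
    by apply: Ccl => e /ul[N /(_ N (leqnn N)) h]; exists (u N).
  apply/ler_addgt0Pr => e e0.
  have e3 : 0 < e / 3 by lra.
  have [d d0 hd] := inner_small (l - p) e3.
  have [N1 h1] := ul _ d0; have [N2 h2] := hM _ e3.
  have := hd _ (h1 (maxn N1 N2) (leq_maxl _ _)); rewrite ltr_norml => /andP[h3 _].
  have := h2 _ (leq_maxr N1 N2); rewrite (inner_sub_expand _ l).
  have := inner_ge0 (u (maxn N1 N2) - l); lra.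
exists q; split=> // z Cz.
rewrite leNgt; apply/negP => h.
set b := inner (p - q) (z - q) in h.
set a := inner (z - q) (z - q).
have a0 : 0 <= a := inner_ge0 _.
(* The squared distance changes by - t (2 b - t a), and t (a + b) = b turns the second factor into b
   + t b > 0. *)
set t := b / (a + b).
have t0 : 0 < t by rewrite divr_gt0//; lra.
have t1 : t * (a + b) = b by rewrite /t divfK//; lra.
have t2 : t <= 1 by rewrite ler_pdivrMr; lra.
have Ct : C (t *: z + (1 - t) *: q) by apply: Cconv => //; apply/andP; split; lra.
have := hq _ Ct.
have -> : inner (t *: z + (1 - t) *: q - p) (t *: z + (1 - t) *: q - p) =
    inner (q - p) (q - p) - t * (2 * b - t * a).
  rewrite /b /a !innerE (innerC q p) (innerC z p) (innerC z q); ring.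
rewrite lerBrDr gerDl leNgt => /negP; apply.
have tb : 0 < t * b by rewrite mulr_gt0.
by rewrite mulr_gt0//; lra.
Qed.

End inner_theory.

(** * Completeness of Hilbert spaces, of the scalars and of products for the inner product *)

Section completeness.
Context (R : realType).

Lemma norm_cauchy_cvg (V : completeNormedModType R) (u : nat -> V) :
  (forall e, 0 < e -> exists N, forall i j, (N <= i)%N -> (N <= j)%N ->
    `|u i - u j| < e) ->
  exists l, forall e, 0 < e -> exists N, forall n, (N <= n)%N -> `|u n - l| < e.
Proof.
move=> uC.
have : cvg (u @ \oo).
  apply/cauchy_cvgP/cauchy_exP => e /uC[N hN]; exists (u N); exists N => // n /= Nn.
  by rewrite -ball_normE /=; exact: hN.
move=> /cvg_ex[l /cvgrPdist_lt ul]; exists l => e /ul[N _ hN]; exists N => n Nn.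
by rewrite distrC; exact: hN.
Qed.

Lemma inner_complete_norm (V : completeNormedModType R) (dot : V -> R) :
  (forall x, dot x = `|x| ^+ 2) ->
  forall u : nat -> V,
  (forall e, 0 < e -> exists N, forall i j, (N <= i)%N -> (N <= j)%N ->
    dot (u i - u j) < e) ->
  exists l, forall e, 0 < e -> exists N, forall n, (N <= n)%N ->
    dot (u n - l) < e.
Proof.
move=> dotE u uC.
have [e e0|l hl] := @norm_cauchy_cvg V u.
  have [N hN] := uC (e ^+ 2) (exprn_gt0 2 e0); exists N => i j Ni Nj.
  by have := hN _ _ Ni Nj; rewrite dotE ltr_sqr ?nnegrE// ltW.
exists l => e e0.
have e1 : 0 < Num.sqrt e by rewrite sqrtr_gt0.
have [N hN] := hl _ e1; exists N => n /hN h.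
by rewrite dotE -[ltRHS]sqr_sqrtr ?(ltW e0)// ltr_sqr ?nnegrE// ltW.
Qed.

Lemma hilbert_norm_sqr (H : hilbertType R) (x : H) : `|x| ^+ 2 = inner x x.
Proof. by rewrite normr_inner /inorm sqr_sqrtr// inner_ge0. Qed.

Lemma hilbert_inner_complete (H : hilbertType R) : inner_complete H.
Proof.
apply: (@inner_complete_norm H (fun x => inner x x)) => x.
by rewrite hilbert_norm_sqr.
Qed.

Lemma scalar_inner_complete : inner_complete (R : innerType R).
Proof.
apply: (@inner_complete_norm R (fun x : R => inner (x : (R : innerType R)) x)) => x.
by rewrite real_normK ?num_real// expr2.
Qed.

Lemma prod_inner_complete (V W : innerType R) :
  inner_complete V -> inner_complete W -> inner_complete (V * W)%type.
Proof.
move=> Vc Wc u uC.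
have uC1 e : 0 < e -> exists N, forall i j, (N <= i)%N -> (N <= j)%N ->
    inner ((u i).1 - (u j).1) ((u i).1 - (u j).1) < e.
  move=> /uC[N hN]; exists N => i j Ni Nj; apply: le_lt_trans (hN i j Ni Nj).
  by rewrite /inner/= lerDl inner_ge0.
have uC2 e : 0 < e -> exists N, forall i j, (N <= i)%N -> (N <= j)%N ->
    inner ((u i).2 - (u j).2) ((u i).2 - (u j).2) < e.
  move=> /uC[N hN]; exists N => i j Ni Nj; apply: le_lt_trans (hN i j Ni Nj).
  by rewrite /inner/= lerDr inner_ge0.
have [l1 h1] := Vc (fun n => (u n).1) uC1.
have [l2 h2] := Wc (fun n => (u n).2) uC2.
exists (l1, l2) => e e0; have e2 : 0 < e / 2 by rewrite divr_gt0.
have [N1 hN1] := h1 _ e2; have [N2 hN2] := h2 _ e2.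
exists (maxn N1 N2) => n; rewrite geq_max => /andP[/hN1 n1 /hN2 n2].
by rewrite [e]splitr /inner/= ltrD.
Qed.

Lemma inner_continuous (H : hilbertType R) (y : H) :
  continuous (fun x : H => inner x y).
Proof.
move=> x; apply/cvgrPdist_lt => e e0.
have [d d0 hd] := inner_small y e0.
have d1 : 0 < Num.sqrt d by rewrite sqrtr_gt0.
have := nbhsx_ballx x _ d1; apply: filterS => z; rewrite -ball_normE /= -innerBl => xz; apply: hd.
by rewrite -hilbert_norm_sqr -[ltRHS]sqr_sqrtr ?(ltW d0)// ltr_sqr ?nnegrE ?(ltW d1).
Qed.

End completeness.

(** * Conjugacy through epigraphs, recession functions and perspectives *)

Section epi_duality.
Context (R : realType).
Local Open Scope ereal_scope.

(* h is the B-conjugate of k, stated with epigraphs so that no infinite value is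
   ever subtracted. *)
Definition epi_dual (V W : Type) (B : V -> W -> R) (h : V -> \bar R)
    (k : W -> \bar R) : Prop :=
  forall x c, h x <= c%:E <-> forall w s, k w <= s%:E -> (B x w <= c + s)%R.

Lemma ereal_finE (x : \bar R) : -oo < x -> x < +oo -> exists a, x = a%:E.
Proof. by case: x => // a _ _; exists a. Qed.

Lemma ereal_le_finE (x : \bar R) c : -oo < x -> x <= c%:E -> exists2 a, x = a%:E & (a <= c)%R.
Proof. by case: x => // a _; rewrite lee_fin; exists a. Qed.

Lemma adde_le_finP (x y : \bar R) c : -oo < x -> -oo < y ->
  x + y <= c%:E <-> exists a b, [/\ x <= a%:E, y <= b%:E & (a + b <= c)%R].
Proof.
move=> x0 y0; split.
  case: x y x0 y0 => [a| |] [b| |]//= _ _; rewrite lee_fin => h.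
  by exists a, b.
move=> [a [b [xa yb ab]]]; apply: le_trans (leeD xa yb) _.
by rewrite -EFinD lee_fin.
Qed.

Lemma archi_le0 (a b : R) : (forall n : nat, n%:R * a <= b)%R -> (a <= 0)%R.
Proof.
move=> h; rewrite leNgt; apply/negP => a0.
have := h (Num.bound (b / a)); apply/negP; rewrite -ltNge -ltr_pdivrMr//.
have [b0|b0] := leP 0%R (b / a)%R; first exact: archi_boundP.
exact: lt_le_trans b0 (ler0n _ _).
Qed.

Lemma scale_pairing_le (t t' k k' b : R) : (0 < t)%R -> (0 < t')%R ->
  (t^-1 * (t'^-1 * b) <= - k / t + - k' / t')%R -> (b + t * k' + k * t' <= 0)%R.
Proof.
move=> t0 t'0; rewrite -(ler_pM2l t0) -(ler_pM2l t'0).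
rewrite mulVKf ?gt_eqF// mulVKf ?gt_eqF// => h.
have : (t' * (t * (- k / t + - k' / t')) = - k * t' - t * k')%R.
  by field; rewrite !gt_eqF.
lra.
Qed.

Lemma recession_iter (V : lmodType R) (h : V -> \bar R) (x y : V) (a c : R) n :
  (forall x, -oo < h x) -> recession h y <= c%:E -> h x <= a%:E ->
  h (x + y *+ n)%R <= (a + n%:R * c)%:E.
Proof.
move=> hN hy hx; elim: n => [|n IH]; first by rewrite mulr0n addr0 mul0r addr0.
have [b hb ba] := ereal_le_finE (hN _) IH.
have : h (x + y *+ n + y)%R - h (x + y *+ n)%R <= c%:E.
  apply: le_trans hy; apply: ereal_sup_ubound; exists (x + y *+ n)%R => //.
  by rewrite /edom/= hb ltry.
rewrite -addrA -mulrSr hb leeBlDr// -EFinD => /le_trans; apply.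
by rewrite lee_fin -natr1; lra.
Qed.

(** The recession function is the support function of the domain of the conjugate. Moving n steps
    along y from a point of the domain raises h by at most n c, so B y w <= c as n grows;
    conversely, adding B y w <= c to the dual inequality at x bounds h at x + y. *)
Lemma recession_leP (V : lmodType R) (W : Type) (B : V -> W -> R)
    (h : V -> \bar R) (k : W -> \bar R) (y : V) (c : R) :
  (forall x y w, B (x + y) w = B x w + B y w)%R ->
  proper_efun h -> epi_dual B h k ->
  recession h y <= c%:E <-> forall w s, k w <= s%:E -> (B y w <= c)%R.
Proof.
move=> BD [hN [x0 hx0]] hk; split.
  move=> hy w s ks; have [a ha] := ereal_finE (hN x0) hx0.
  rewrite -subr_le0; apply: (@archi_le0 _ (a + s - B x0 w)) => n.
  have hx : h x0 <= a%:E by rewrite ha.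
  have /hk/(_ _ _ ks) := recession_iter n hN hy hx.
  have -> : B (x0 + y *+ n)%R w = (B x0 w + n%:R * B y w)%R.
    elim: n => [|n IH]; first by rewrite mulr0n addr0 mul0r addr0.
    by rewrite mulrSr addrA BD IH -natr1; ring.
  lra.
move=> hB; apply: ge_ereal_sup => _ [x xh <-].
have [a ha] := ereal_finE (hN x) xh.
rewrite ha leeBlDr// -EFinD; apply/hk => w s ks; rewrite BD.
have /hk/(_ _ _ ks) : h x <= a%:E by rewrite ha.
have := hB _ _ ks; lra.
Qed.

Section self_dual_perspective.
Context (V : lmodType R) (B : V -> V -> R) (F : V -> \bar R).
Hypothesis BD : forall x y w, (B (x + y) w = B x w + B y w)%R.
Hypothesis BZ : forall a x w, (B (a *: x) w = a * B x w)%R.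
Hypothesis BC : forall x y, B x y = B y x.
Hypothesis Fproper : proper_efun F.
Hypothesis Fdual : epi_dual B F F.

Lemma perspective_pos (z : V) (t k : R) : (0 < t)%R ->
  perspective F (z, t) <= k%:E <-> F (t^-1 *: z)%R <= (k / t)%:E.
Proof.
move=> t0; rewrite /perspective /= t0.
by rewrite mulrC EFinM lee_pdivlMl//.
Qed.

Lemma perspective_zero (z : V) : perspective F (z, 0%R) = recession F z.
Proof. by rewrite /perspective/= ltxx eqxx. Qed.

Lemma perspective_le_ge0 (z : V) (t k : R) :
  perspective F (z, t) <= k%:E -> (0 <= t)%R.
Proof. by rewrite /perspective /=; case: ltgtP. Qed.

(** From left to right, positive t and t' reduce to the conjugacy inequality at z / t and z' / t',
    and a zero one to the support function description of the recession function. From right to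
    left, points with t' = 1 are enough: they recover the epigraph of F. *)
Lemma perspective_self_polar (z : V) (t k : R) :
  perspective F (z, t) <= (- k)%:E <->
  forall z' t' k', perspective F (z', t') <= (- k')%:E ->
    (B z z' + t * k' + k * t' <= 0)%R.
Proof.
have [FN [z0 Fz0]] := Fproper.
have [s0 Fs0] := ereal_finE (FN z0) Fz0.
have z0s0 : F z0 <= s0%:E by rewrite Fs0.
have rec0 w (k1 : R) : recession F w <= k1%:E <->
    forall w' s, F w' <= s%:E -> (B w w' <= k1)%R by exact: recession_leP.
split.
  move=> hz z' t' k' hz'.
  have := perspective_le_ge0 hz; rewrite le_eqVlt => /predU1P[t0|t0].
    rewrite -t0 perspective_zero in hz; rewrite -t0 mul0r addr0.
    have := perspective_le_ge0 hz'; rewrite le_eqVlt => /predU1P[t'0|t'0].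
      rewrite -t'0 perspective_zero in hz'; rewrite -t'0 mulr0 addr0.
      (* Both scalars are zero: z is tested against z0 + n z', which stays in the domain of F, and n
         tends to infinity. *)
      apply: (@archi_le0 _ (- k - B z z0)) => n.
      have h := recession_iter n FN hz' z0s0.
      have := proj1 (rec0 _ _) hz _ _ h; rewrite BC BD BC.
      have -> : B (z' *+ n) z = (n%:R * B z z')%R.
        by rewrite -scaler_nat BZ BC.
      lra.
    move/(perspective_pos _ _ t'0) in hz'.
    have := proj1 (rec0 _ _) hz _ _ hz'.
    by rewrite BC BZ BC mulrC ler_pdivrMr//; lra.
  move/(perspective_pos _ _ t0) in hz.
  have := perspective_le_ge0 hz'; rewrite le_eqVlt => /predU1P[t'0|t'0].
    rewrite -t'0 perspective_zero in hz'; rewrite -t'0 mulr0 addr0.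
    have := proj1 (rec0 _ _) hz' _ _ hz.
    by rewrite BC BZ mulrC ler_pdivrMr//; lra.
  move/(perspective_pos _ _ t'0) in hz'.
  have := proj1 (Fdual _ _) hz _ _ hz'.
  rewrite BZ BC BZ BC => h.
  exact: scale_pairing_le t0 t'0 h.
move=> H.
have test w s : F w <= s%:E -> (B z w - t * s + k <= 0)%R.
  move=> ws; have := H w 1%R (- s)%R; rewrite mulr1 mulrN; apply.
  by apply/perspective_pos => //; rewrite invr1 scale1r mulr1 opprK.
have t0 : (0 <= t)%R.
  (* The epigraph of F contains (z0, s0 + n) for every n, which excludes a negative t. *)
  rewrite -oppr_le0; apply: (@archi_le0 _ (t * s0 - B z z0 - k)) => n.
  have : F z0 <= (s0 + n%:R)%:E.
    by apply: le_trans z0s0 _; rewrite lee_fin lerDl.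
  by move=> /test; lra.
move: t0; rewrite le_eqVlt => /predU1P[t0|t0].
  rewrite -t0 perspective_zero; apply/rec0 => w s /test.
  by rewrite -t0; lra.
apply/perspective_pos => //; apply/Fdual => w s /test.
rewrite BZ ler_pdivrMl// mulrDr mulrCA divff ?gt_eqF// mulr1; lra.
Qed.

End self_dual_perspective.

(** * The self-dual function h(x) + k(v) and its recession function *)

Section separable_self_dual.
Context (V : innerType R) (h k : V -> \bar R).
Hypothesis hproper : proper_efun h.
Hypothesis kproper : proper_efun k.
Hypothesis hk : epi_dual (@inner R V) h k.
Hypothesis kh : epi_dual (@inner R V) k h.

Definition swap_pairing (z w : V * V) : R := (inner z.1 w.2 + inner z.2 w.1)%R.

Lemma separable_proper : proper_efun (fun z : V * V => h z.1 + k z.2).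
Proof.
have [hN [x hx]] := hproper; have [kN [y ky]] := kproper; split.
  move=> [a b]/=; have := hN a; have := kN b.
  by case: (h a) => [?| |]//; case: (k b) => [?| |]// _ _; rewrite ltNyr.
exists (x, y) => /=; have [a ->] := ereal_finE (hN _) hx.
by have [b ->] := ereal_finE (kN _) ky; rewrite -EFinD ltry.
Qed.

(** One direction adds the Fenchel-Young inequalities of the pairs (x, y') and (y, x'). For the
    other, the joint supremum is split one variable at a time. *)
Lemma separable_self_dual :
  epi_dual swap_pairing (fun z : V * V => h z.1 + k z.2)
    (fun z : V * V => h z.1 + k z.2).
Proof.
have [hN [x0 hx0]] := hproper; have [kN [y0 ky0]] := kproper.
have [a0 ha0] := ereal_finE (hN _) hx0; have [b0 kb0] := ereal_finE (kN _) ky0.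
move=> [x y] c; split=> /=.
  move=> /adde_le_finP-/(_ (hN _) (kN _))[a [b [ha kb abc]]] [x' y'] s /=.
  move=> /adde_le_finP-/(_ (hN _) (kN _))[a' [b' [ha' kb' abc']]].
  rewrite /swap_pairing /=.
  have := proj1 (hk _ _) ha _ _ kb'; have := proj1 (kh _ _) kb _ _ ha'; lra.
move=> H.
have test x' y' a b : h x' <= a%:E -> k y' <= b%:E ->
    (inner x y' + inner y x' <= c + (a + b))%R.
  move=> ha kb; apply: (H (x', y')) => /=.
  by apply/adde_le_finP => //; exists a, b.
(* A crude bound from the point x0 of the domain: it makes h x a real number a, which can then be
   moved across the inequality. *)
have : h x <= (c + a0 - inner y x0)%:E.
  apply/hk => w s kw; have : h x0 <= a0%:E by rewrite ha0.
  by move=> /test/(_ kw); lra.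
move=> /(ereal_le_finE (hN _))[a ha ac].
apply/adde_le_finP => //; exists a, (c - a)%R; rewrite ha; split=> //; last lra.
apply/kh => w s hw.
have : h x <= (c + s - inner y w)%:E.
  by apply/hk => w' s' kw'; have := test _ _ _ _ hw kw'; lra.
by rewrite ha lee_fin; lra.
Qed.

(** By [recession_leP] both sides are support functions, and the one of a product of domains is the
    sum of the two; the supremum is split as in [separable_self_dual]. *)
Lemma recession_separable (x y : V) (c : R) :
  recession (fun z : V * V => h z.1 + k z.2) (x, y) <= c%:E <->
  recession h x + recession k y <= c%:E.
Proof.
have [hN [x0 hx0]] := hproper; have [kN [y0 ky0]] := kproper.
have [a0 ha0] := ereal_finE (hN _) hx0; have [b0 kb0] := ereal_finE (kN _) ky0.
have hx0' : h x0 <= a0%:E by rewrite ha0.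
have ky0' : k y0 <= b0%:E by rewrite kb0.
have rh w (s : R) : recession h w <= s%:E <->
    forall w' s', k w' <= s'%:E -> (inner w w' <= s)%R.
  by apply: recession_leP => //; exact: innerDl.
have rk w (s : R) : recession k w <= s%:E <->
    forall w' s', h w' <= s'%:E -> (inner w w' <= s)%R.
  by apply: recession_leP => //; exact: innerDl.
(* The support function of a nonempty set never takes the value -oo, so the sum of the two recession
   functions is unambiguous. *)
have rN (g l : V -> \bar R) y1 b1 w : l y1 <= b1%:E ->
    (forall w (s : R), recession g w <= s%:E <->
    forall w' s', l w' <= s'%:E -> (inner w w' <= s)%R) -> -oo < recession g w.
  move=> ly rg; case E : (recession g w) => [s| |]//; first by rewrite ltNyr.
  exfalso; have : recession g w <= (inner w y1 - 1)%:E by rewrite E leNye.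
  by move=> /rg/(_ _ _ ly); lra.
rewrite (recession_leP (B := swap_pairing) (k := fun z => h z.1 + k z.2));
  [|by move=> ? ? ?; rewrite /swap_pairing /= !innerDl; ring
   |exact: separable_proper|exact: separable_self_dual].
split.
  move=> H.
  have test x' y' a b : h x' <= a%:E -> k y' <= b%:E ->
      (inner x y' + inner y x' <= c)%R.
    move=> ha kb; apply: (H (x', y') (a + b)%R) => /=.
    by apply/adde_le_finP => //; exists a, b.
  have : recession h x <= (c - inner y x0)%:E.
    by apply/rh => w s kw; have := test _ _ _ _ hx0' kw; lra.
  move=> /(ereal_le_finE (rN _ _ _ _ _ ky0' rh))[a ha ac].
  rewrite ha -leeBrDl//-EFinB; apply/rk => w s hw.
  have : recession h x <= (c - inner y w)%:E.
    by apply/rh => w' s' kw'; have := test _ _ _ _ hw kw'; lra.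
  by rewrite ha lee_fin; lra.
move=> /adde_le_finP-/(_ (rN _ _ _ _ _ ky0' rh) (rN _ _ _ _ _ hx0' rk)).
move=> [a [b [ha kb abc]]] [x' y'] s /adde_le_finP-/(_ (hN _) (kN _)) /=.
move=> [a' [b' [ha' kb' abc']]]; rewrite /swap_pairing/=.
have := proj1 (rh _ _) ha _ _ kb'; have := proj1 (rk _ _) kb _ _ ha'; lra.
Qed.

End separable_self_dual.

End epi_duality.

(** * Functions in Gamma0: proximal points, biconjugation and [Prox] *)

Section gamma0.
Context (R : realType) (H : hilbertType R) (f : H -> \bar R).
Hypothesis fG : Gamma0 f.
Local Open Scope ereal_scope.

Let fN x : -oo < f x.
Proof. by case: fG => -[]. Qed.

Lemma lsc_inner (x : H) (b : R) : b%:E < f x ->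
  exists2 d, (0 < d)%R & forall y, (inner (y - x) (y - x) < d)%R -> b%:E < f y.
Proof.
case: fG => _ flsc _ /flsc[U /nbhs_ballP[e /= e0 eU] hU].
exists (e ^+ 2)%R; first exact: exprn_gt0.
move=> y yx; apply/hU/eU; rewrite -ball_normE /= distrC.
by rewrite -ltr_sqr ?nnegrE ?(ltW e0)// hilbert_norm_sqr.
Qed.

Lemma convex_epi (x y : H) (a b t : R) : (0 < t < 1)%R ->
  f x <= a%:E -> f y <= b%:E ->
  f (t *: x + (1 - t) *: y)%R <= (t * a + (1 - t) * b)%:E.
Proof.
move=> t01 fx fy; case: fG => _ _ fconv.
apply: le_trans (fconv x y t t01) _; case/andP: t01 => t0 t1.
rewrite (EFinD (t * a)%R) !EFinM leeD// lee_wpmul2l// lee_fin; lra.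
Qed.

(* Lower semicontinuity bounds f below near x0; convexity along the rays from
   x0 propagates the bound with linear decay. *)
Lemma convex_lsc_minorant (x0 : H) : f x0 < +oo ->
  exists A B, (0 <= B)%R /\ forall x c, f x <= c%:E -> (A - B * `|x - x0| <= c)%R.
Proof.
move=> fx0; have [a ha] := ereal_finE (fN x0) fx0.
have [|d d0 hd] := @lsc_inner x0 (a - 1); first by rewrite ha lte_fin; lra.
have s0 : (0 < Num.sqrt d)%R by rewrite sqrtr_gt0.
set s := (Num.sqrt d / 2)%R; have ss : (0 < s)%R by rewrite divr_gt0.
have hs y : (`|y - x0| <= s)%R -> (a - 1)%:E < f y.
  move=> ys; apply: hd; rewrite -hilbert_norm_sqr -[ltRHS]sqr_sqrtr ?(ltW d0)//.
  by rewrite ltr_sqr ?nnegrE ?(ltW s0)// (le_lt_trans ys)// /s; lra.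
exists (a - 1)%R, (s^-1)%R; split; first by rewrite invr_ge0 ltW.
move=> x c fx; set n := (`|x - x0|)%R.
have n0 : (0 <= n)%R by exact: normr_ge0.
have si : (0 < s^-1)%R by rewrite invr_gt0.
have sn : (0 <= s^-1 * n)%R by rewrite mulr_ge0// ltW.
have [ns|ns] := leP n s.
  have := lt_le_trans (hs _ ns) fx; rewrite lte_fin; lra.
have n1 : (0 < n)%R by lra.
set t := (s / n)%R.
have t0 : (0 < t)%R by rewrite divr_gt0.
have t1 : (t < 1)%R by rewrite ltr_pdivrMr// mul1r.
have tn : (t * n = s)%R by rewrite /t divfK ?gt_eqF.
have fa : f x0 <= a%:E by rewrite ha.
have t01 : (0 < t < 1)%R by rewrite t0 t1.
have := convex_epi t01 fx fa => /(lt_le_trans (hs _ _)).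
have -> : (t *: x + (1 - t) *: x0 - x0 = t *: (x - x0))%R.
  by rewrite scalerBl scale1r scalerBr -!addrA; congr (_ + _)%R; rewrite addrC subrK.
rewrite normrZ gtr0_norm// -/n tn lexx => /(_ isT); rewrite lte_fin => h.
have h1 : (t * (s^-1 * n) = 1)%R by rewrite mulrCA tn mulVf ?gt_eqF.
rewrite -(ler_pM2l t0); lra.
Qed.

(** The point y minimizes f + (c/2) |. - a|^2, and the inequality says that c (a - y) is a
    subgradient of f at y. It comes from comparing y with points t z + (1 - t) y for small t. *)
Lemma prox_exists (c : R) (a : H) : (0 < c)%R ->
  exists y fy, f y = fy%:E /\
    forall z s, f z <= s%:E -> (fy + c * inner (a - y) (z - y) <= s)%R.
Proof.
move=> c0; case: (fG) => -[_ [x0 fx0]] _ _.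
have [A [B [B0 minor]]] := convex_lsc_minorant fx0.
have fK x : edom f x -> f x = (fine (f x))%:E.
  by move=> xf; have [b ->] := ereal_finE (fN x) xf.
have fKle x : edom f x -> f x <= (fine (f x))%:E by move=> /fK <-.
set phi := fun x : H => (fine (f x) + c / 2 * inner (x - a) (x - a))%R.
have hm x : edom f x -> (A - B * `|a - x0| - B ^+ 2 / (2 * c) <= phi x)%R.
  move=> /fKle/minor; rewrite /phi => h.
  have tri : (`|x - x0| <= `|x - a| + `|a - x0|)%R by exact: ler_distD.
  have := ler_wpM2l B0 tri; rewrite -hilbert_norm_sqr.
  (* Completing the square: the quadratic term absorbs the linear decay of the minorant of f. *)
  have : (0 <= c / 2 * (`|x - a| - B / c) ^+ 2)%R by rewrite mulr_ge0 ?sqr_ge0//; lra.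
  have -> : (c / 2 * (`|x - a| - B / c) ^+ 2 =
    c / 2 * `|x - a| ^+ 2 - B * `|x - a| + B ^+ 2 / (2 * c))%R.
    by field; rewrite gt_eqF.
  lra.
have [||||y fy hy] := @strongly_convex_min _ _ (edom f) phi (c / 8) _ _ _ _ hm.
- lra.
- by exists x0.
- move=> x y /fKle fx /fKle fy.
  have h2 : (0 < (2^-1 : R) < 1)%R by apply/andP; split; lra.
  have := convex_epi h2 fx fy.
  have -> : (1 - 2^-1 = 2^-1 :> R)%R by lra.
  rewrite -scalerDr => h; have dm : edom f (2^-1 *: (x + y)).
    by apply: le_lt_trans h _; rewrite ltry.
  split=> //; move: h; rewrite (fK _ dm) lee_fin /phi inner_midpoint; lra.
- move=> u M uf /hilbert_inner_complete[l ul] hM.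
  (* Lower semicontinuity is used at real b below f l, since f l might still be +oo; large b then
     show that it is finite. *)
  have lim b : b%:E < f l -> (b + c / 2 * inner (l - a) (l - a) <= M)%R.
    move=> bl; apply/ler_addgt0Pr => e e0.
    have e3 : (0 < e / (1 + c))%R by rewrite divr_gt0//; lra.
    have ee : (e / (1 + c) * (1 + c) = e)%R by rewrite divfK// gt_eqF//; lra.
    have [d d0 hd] := inner_small (l - a)%R e3.
    have [d' d'0 hd'] := lsc_inner bl.
    have dd : (0 < Num.min d d')%R by rewrite lt_min d0.
    have [N1 h1] := ul _ dd; have [N2 h2] := hM _ e3.
    set n := maxn N1 N2.
    have := h1 n (leq_maxl _ _); rewrite lt_min => /andP[/hd n1 /hd'].
    rewrite (fK _ (uf n)) lte_fin => n2.
    have := h2 n (leq_maxr _ _); rewrite /phi (inner_sub_expand _ l).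
    have := inner_ge0 (u n - l)%R; move: n1; rewrite ltr_norml => /andP[n1 _].
    move: (inner (u n - l) (u n - l))%R n1 => q n1 q0 h.
    move: (inner (u n - l) (l - a))%R n1 h => w n1 h.
    have : (0 <= c / 2 * (q + 2 * (w + e / (1 + c))))%R by rewrite mulr_ge0//; lra.
    rewrite !mulrDr; lra.
  have lf : edom f l.
    rewrite /edom /= ltNge leye_eq; apply/eqP => fl.
    have := lim (M + 1 - c / 2 * inner (l - a) (l - a))%R.
    by rewrite fl ltry => /(_ isT); lra.
  exists l => //; rewrite /phi; apply/ler_addgt0Pr => e e0.
  have := lim (fine (f l) - e)%R; rewrite [X in _ < X]fK// lte_fin.
  by rewrite ltrBlDr ltrDl e0 => /(_ isT); lra.
exists y, (fine (f y)); split; first exact: fK.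
move=> z s fz.
have hfy := fKle _ fy.
apply/ler_addgt0Pr => e e0.
set Q := inner (z - y)%R (z - y)%R.
have Q0 : (0 <= Q)%R by exact: inner_ge0.
(* With this t the quadratic error, once divided by t, is at most e. *)
set t := Num.min (2^-1)%R (e / (c * (Q + 1)))%R.
have cQ : (0 < c * (Q + 1))%R by rewrite mulr_gt0//; lra.
have t0 : (0 < t)%R by rewrite lt_min divr_gt0// andbT; lra.
have t1 : (t <= 2^-1)%R by rewrite ge_min lexx.
have t2 : (t * (c * (Q + 1)) <= e)%R by rewrite -ler_pdivlMr ?ge_min ?lexx ?orbT.
have t01 : (0 < t < 1)%R by apply/andP; split; lra.
have := convex_epi t01 fz hfy => h.
set w := (t *: z + (1 - t) *: y)%R in h.
have wf : edom f w by apply: le_lt_trans h _; rewrite ltry.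
have := hy _ wf; rewrite /phi; move: h; rewrite [X in X <= _]fK// lee_fin => h.
have -> : (inner (w - a) (w - a) = inner (y - a) (y - a)
   - 2 * t * inner (a - y) (z - y) + t * (t * Q))%R.
  rewrite /w /Q !innerE (innerC a y) (innerC a z) (innerC z y); ring.
move=> h'; rewrite -(ler_pM2l t0).
have tc : (0 <= t * c)%R by rewrite mulr_ge0// ltW.
have : (t * (t * (c * (Q + 1))) <= t * e)%R by rewrite ler_pM2l.
have tt : (0 <= t * t * c)%R by rewrite !mulr_ge0// ltW.
have ttQ : (0 <= t * t * c * Q)%R by rewrite mulr_ge0.
lra.
Qed.

Lemma fenchel_conj_leP u c :
  fenchel_conj f u <= c%:E <-> forall x s, f x <= s%:E -> (inner u x <= c + s)%R.
Proof.
split=> [h x s fx|h].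
  have [b fb bs] := ereal_le_finE (fN x) fx.
  have : (inner x u)%:E - f x <= c%:E.
    by apply: le_trans h; apply: ereal_sup_ubound; exists x.
  by rewrite fb -EFinB lee_fin innerC; lra.
apply: ge_ereal_sup => _ [x _ <-].
have := fN x; case E : (f x) => [b| |]// _; last by rewrite leNye.
rewrite -EFinB lee_fin innerC.
by have := h x b; rewrite E => /(_ (lexx _)); lra.
Qed.

Lemma fenchel_conj_dual : epi_dual (@inner R H) (fenchel_conj f) f.
Proof. by move=> u c; exact: fenchel_conj_leP. Qed.

(** A domain point of f excludes the value -oo. The conjugate is finite somewhere because the
    proximal point y of 0 has - y as a subgradient, so the conjugate is bounded above at - y. *)
Lemma fenchel_conj_proper : proper_efun (fenchel_conj f).
Proof.
case: (fG) => -[_ [x0 fx0]] _ _; split.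
  move=> u; case E : (fenchel_conj f u) => [s| |]//; first by rewrite ltNyr.
  exfalso; have [a ha] := ereal_finE (fN x0) fx0.
  have : fenchel_conj f u <= (inner u x0 - a - 1)%:E by rewrite E leNye.
  by move=> /fenchel_conj_leP/(_ x0 a); rewrite ha => /(_ (lexx _)); lra.
have [y [fy [_ h]]] := prox_exists 0%R (@ltr01 R).
exists (- y)%R; apply: (@le_lt_trans _ _ (inner y (- y) - fy)%:E); last exact: ltry.
apply/fenchel_conj_leP => x s /h.
rewrite sub0r mul1r innerBr (innerC y (- y)%R); lra.
Qed.

(* Proximal points of f / n at x converge to x, and their subgradients test the
   biconjugate inequality. *)
Lemma fenchel_moreau : epi_dual (@inner R H) f (fenchel_conj f).
Proof.
move=> x c; split.
  move=> fx w s /fenchel_conj_leP/(_ _ _ fx); rewrite innerC; lra.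
move=> h; rewrite leNgt; apply/negP => /lsc_inner[d d0 hd].
case: (fG) => -[_ [x0 fx0]] _ _.
have [A [B [B0 minor]]] := convex_lsc_minorant fx0.
(* The subgradient inequality, the minorant at y and 2 B |x - y| <= B^2 + |x - y|^2 bound (n - 1) |x
   - y|^2 by [D]; the next choice of n therefore brings y within the neighbourhood where f > c. *)
set D := (c - A + B * `|x - x0| + B ^+ 2)%R.
set n := (Num.max 0 D / d + 2)%R.
have n0 : (0 < n)%R.
  by rewrite ltr_wpDl// divr_ge0 ?(ltW d0)// le_max lexx.
have nd : (D < (n - 1) * d)%R.
  have : (Num.max 0 D / d * d = Num.max 0 D)%R by rewrite divfK// gt_eqF.
  have : (D <= Num.max 0 D)%R by rewrite le_max lexx orbT.
  by rewrite /n; lra.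
have n1 : (0 < n - 1)%R.
  have : (0 <= Num.max 0 D / d)%R by rewrite divr_ge0 ?(ltW d0)// le_max lexx.
  by rewrite /n; lra.
have [y [fy [fyE hy]]] := prox_exists x n0.
have conj : fenchel_conj f (n *: (x - y))%R <= (inner (n *: (x - y)) y - fy)%:E.
  apply/fenchel_conj_leP => z s /hy; rewrite innerBr !innerZl; lra.
have := h _ _ conj; rewrite innerC => hxy.
have key : (n * inner (x - y) (x - y) <= c - fy)%R.
  have -> : (n * inner (x - y) (x - y) =
    inner (n *: (x - y)) x - inner (n *: (x - y)) y)%R.
    by rewrite -innerBr innerZl.
  lra.
have fyle : f y <= fy%:E by rewrite fyE.
have := minor _ _ fyle => hmin.
have tri : (`|y - x0| <= `|x - y| + `|x - x0|)%R by rewrite (distrC x y) ler_distD.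
have := ler_wpM2l B0 tri => tri'.
rewrite -hilbert_norm_sqr in key.
have := sqr_ge0 (B - `|x - y|)%R; rewrite sqrrB => sq.
have := sqr_ge0 B; have := sqr_ge0 (`|x - y|)%R => p0 p1.
have yx : (inner (y - x) (y - x) < d)%R.
  rewrite -hilbert_norm_sqr distrC -(ltr_pM2l n1); apply: le_lt_trans nd.
  rewrite /D; move: key sq hmin tri'.
  move: (`|x - y|)%R (`|x - x0|)%R (`|y - x0|)%R p0 => r1 r2 r3; lra.
have := hd _ yx; rewrite fyE lte_fin.
have : (0 <= n * `|x - y| ^+ 2)%R by rewrite mulr_ge0// ltW.
lra.
Qed.

(** The equality case of the Fenchel-Young inequality: a - y is a subgradient of f at y. *)
Lemma subgradient_leP (y a : H) :
  f y + fenchel_conj f (a - y)%R <= (inner y (a - y))%:E <->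
  exists2 fy, f y = fy%:E & forall z s, f z <= s%:E ->
    (fy + inner (a - y) (z - y) <= s)%R.
Proof.
have [kN _] := fenchel_conj_proper.
rewrite adde_le_finP//; split.
  move=> [b [c [fb kc bc]]]; have [fy fyE fyb] := ereal_le_finE (fN y) fb.
  exists fy => // z s; move/fenchel_conj_leP: kc => kc /kc.
  by rewrite [inner _ (z - y)%R]innerBr (innerC (a - y)%R y); lra.
move=> [fy fyE h]; exists fy, (inner y (a - y) - fy)%R; split; rewrite ?fyE//.
- apply/fenchel_conj_leP => z s /h; rewrite innerBr (innerC (a - y)%R y); lra.
- lra.
Qed.

(** A subgradient a - y makes y the minimizer with margin |z - y|^2 / 2, hence the only one, and
    [xget] returns it. Conversely, [prox_exists] provides some point with this property, and that
    point must be [Prox f a]. *)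
Lemma ProxP (y a : H) :
  f y + fenchel_conj f (a - y)%R <= (inner y (a - y))%:E <-> Prox f a = y.
Proof.
have Prox_of y' : f y' + fenchel_conj f (a - y')%R <= (inner y' (a - y'))%:E ->
    Prox f a = y'.
  move=> /subgradient_leP[fy fyE h].
  have strict z s : f z <= s%:E ->
      (fy + 2^-1 * `|y' - a| ^+ 2 + 2^-1 * `|z - y'| ^+ 2
        <= s + 2^-1 * `|z - a| ^+ 2)%R.
    move=> /h; rewrite !hilbert_norm_sqr (inner_sub_expand z y' a).
    by rewrite -[(a - y')%R]opprB innerNl (innerC (z - y')%R); lra.
  rewrite /Prox; case: xgetP => [x -> {x}|].
    set x := xget _ _ => -[_ /(_ y' I)]; rewrite fyE => hx.
    have := fN x; case E : (f x) hx => [b| |]//; last first.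
    have := strict x b; rewrite E => /(_ (lexx _)) hs; rewrite -!EFinD lee_fin => h1 _.
    apply/eqP; rewrite -subr_eq0 -normr_le0; apply: contraTT (sqr_ge0 (`|x - y'|)%R).
    rewrite -!ltNge => x0; have := exprn_gt0 2 x0; lra.
  move=> /(_ y')[]; split=> // z _; rewrite fyE.
  have := fN z; case E : (f z) => [b| |]// _; last by rewrite leey.
  have := strict z b; rewrite E => /(_ (lexx _)) hs; rewrite -!EFinD lee_fin.
  have := sqr_ge0 (`|z - y'|)%R; lra.
split=> [|<-]; first exact: Prox_of.
have [q [fq [fqE h]]] := prox_exists a (@ltr01 R).
have hq : f q + fenchel_conj f (a - q)%R <= (inner q (a - q))%:E.
  by apply/subgradient_leP; exists fq => // z s /h; rewrite mul1r.
by rewrite (Prox_of _ hq).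
Qed.

End gamma0.

(** * Polar cones *)

Section polar.
Context (R : realType) (V : innerType R) (D : set V).

Definition polar : set V := [set z | forall d, D d -> inner d z <= 0].

Lemma polar0 : polar 0.
Proof. by move=> d _; rewrite inner0r. Qed.

Lemma polar_add x y : polar x -> polar y -> polar (x + y).
Proof. by move=> hx hy d Dd; rewrite innerDr -[leRHS]addr0 lerD ?hx ?hy. Qed.

Lemma polar_scale a x : 0 <= a -> polar x -> polar (a *: x).
Proof. by move=> a0 hx d /hx; rewrite innerZr => h; rewrite mulr_ge0_le0. Qed.

Lemma polar_convex : convex_set (polar : set (convex_lmodType V)).
Proof.
move=> x y l; rewrite !inE => hx hy.
change (polar (l%:inum *: (x : V) + (1 - l%:inum) *: (y : V))).
by apply: polar_add; apply: polar_scale => //; rewrite subr_ge0.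
Qed.

Lemma polar_cone : is_cone polar.
Proof. by move=> a x a0; apply: polar_scale; exact: ltW. Qed.

(** Closedness for the inner product distance, the form that [metric_proj_exists] asks for;
    [polar_closed] is its counterpart for the product topology. *)
Lemma polar_inner_closed l :
  (forall e, 0 < e -> exists2 x, polar x & inner (x - l) (x - l) < e) -> polar l.
Proof.
move=> h d Dd; apply/ler_addgt0Pr => e e0; rewrite add0r.
have [c c0 hc] := inner_small d e0.
have [x /(_ _ Dd) hx /hc] := h _ c0.
rewrite innerBl ltr_norml (innerC x) (innerC l) => /andP[? _]; lra.
Qed.

End polar.

(** * The product space of the cones, with its swap and flip *)

Section cone_space.
Context (R : realType) (H : hilbertType R).
Local Notation E := (H * H * R * R)%type.

Lemma cone_space_innerE (x v x' v' : H) (t k t' k' : R) :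
  inner ((x, v, t, k) : E) (x', v', t', k') =
  inner x x' + inner v v' + t * t' + k * k'.
Proof. by []. Qed.

Lemma polar_closed (D : set E) : closed (polar D).
Proof.
have -> : polar D = \bigcap_(d in D) [set z | inner d z <= 0] by [].
apply: closed_bigI.
move=> [[[x v] t] k] _.
pose phi (z : E) : R :=
  inner z.1.1.1 x + inner z.1.1.2 v + t * z.1.2 + k * z.2.
have -> : [set z | inner (x, v, t, k) z <= 0] = phi @^-1` [set u : R | u <= 0].
  apply/seteqP; split=> -[[[a b] c] d] /=; rewrite /phi /= cone_space_innerE;
  by rewrite (innerC x) (innerC v).
apply: preimage_closed; last exact: closed_le.
have fstc (S T : topologicalType) : continuous (@fst S T).
  by move=> z; exact: cvg_fst.
have sndc (S T : topologicalType) : continuous (@snd S T).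
  by move=> z; exact: cvg_snd.
have fst2 : continuous (fun z : E => z.1.1).
  by move=> z; apply: (@continuous_comp _ _ _ fst fst); exact: fstc.
have c1 : continuous (fun z : E => inner z.1.1.1 x).
  move=> z; apply: (@continuous_comp E H R (fun z : E => z.1.1.1) (fun a : H => inner a x)).
    apply: (@continuous_comp _ _ _ (fun z : E => z.1.1) fst); first exact: fst2.
    exact: fstc.
  exact: inner_continuous.
have c2 : continuous (fun z : E => inner z.1.1.2 v).
  move=> z; apply: (@continuous_comp E H R (fun z : E => z.1.1.2) (fun a : H => inner a v)).
    apply: (@continuous_comp _ _ _ (fun z : E => z.1.1) snd); first exact: fst2.
    exact: sndc.
  exact: inner_continuous.
have c3 : continuous (fun z : E => z.1.2).
  by move=> z; apply: (@continuous_comp _ _ _ fst snd); [exact: fstc|exact: sndc].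
have c4 : continuous (fun z : E => z.2) by exact: sndc.
move=> z _; rewrite /phi; apply: cvgD; last by apply: cvgMl_tmp; exact: c4.
apply: cvgD; last by apply: cvgMl_tmp; exact: c3.
by apply: cvgD; [exact: c1|exact: c2].
Qed.

Definition cone_swap (z : E) : E := (z.1.1.2, z.1.1.1, z.2, z.1.2).

Definition cone_flip (z : E) : E := (z.1.1.1, - z.1.1.2, z.1.2, - z.2).

Lemma inner_cone_swap (z w : E) : inner (cone_swap z) (cone_swap w) = inner z w.
Proof.
case: z w => [[[a b] c] d] [[[a' b'] c'] d'].
by rewrite /cone_swap /= !cone_space_innerE; ring.
Qed.

Lemma inner_cone_flip (z w : E) : inner (cone_flip z) w = inner z (cone_flip w).
Proof.
case: z w => [[[a b] c] d] [[[a' b'] c'] d'].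
by rewrite /cone_flip /= !cone_space_innerE innerNl innerNr mulrN mulNr.
Qed.

Lemma cone_flipK : involutive cone_flip.
Proof. by move=> [[[a b] c] d]; rewrite /cone_flip /= !opprK. Qed.

Lemma cone_flipB (z w : E) : cone_flip (z - w) = cone_flip z - cone_flip w.
Proof.
case: z w => [[[a b] c] d] [[[a' b'] c'] d'].
by rewrite /cone_flip /= !opprB; congr (_, _, _, _); rewrite /= opprK addrC.
Qed.

(** The flip is a self-adjoint linear involution, hence an isometry, and carries the variational
    inequality from one set to the other. *)
Lemma is_metric_proj_flip (C C' : set E) w q :
  (forall z, C' z <-> C (cone_flip z)) ->
  is_metric_proj C w q -> is_metric_proj C' (cone_flip w) (cone_flip q).
Proof.
move=> CC' [Cq hq]; split; first by apply/CC'; rewrite cone_flipK.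
move=> z /CC' /hq; rewrite -cone_flipB inner_cone_flip cone_flipB.
by rewrite cone_flipK.
Qed.

Lemma cone_space_complete : inner_complete (E : innerType R).
Proof.
apply: prod_inner_complete; last exact: scalar_inner_complete.
apply: prod_inner_complete; last exact: scalar_inner_complete.
by apply: prod_inner_complete; exact: hilbert_inner_complete.
Qed.

End cone_space.

(** * The cone attached to f and the projection of (p, p, r, r) *)

Section perspective_cone.
Context (R : realType) (H : hilbertType R) (f : H -> \bar R).
Hypothesis fG : Gamma0 f.
Local Notation E := (H * H * R * R)%type.

Definition primal_dual (z : H * H) : \bar R := (f z.1 + fenchel_conj f z.2)%E.

Definition perspective_cone : set E :=
  [set z | (perspective primal_dual z.1 <= (- z.2)%:E)%E].

Local Notation C := perspective_cone.

Let fproper : proper_efun f. Proof. by case: fG. Qed.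
Let fN x : (-oo < f x)%E. Proof. by case: fproper. Qed.
Let kproper := fenchel_conj_proper fG.
Let kN u : (-oo < fenchel_conj f u)%E. Proof. by case: kproper. Qed.
Let fk := fenchel_moreau fG.
Let kf := fenchel_conj_dual fG.

(** This is [perspective_self_polar]: the expression bounded there is the inner product of z with
    the swap of the test point. *)
Lemma perspective_coneP z : C z <-> polar (@cone_swap R H @` C) z.
Proof.
case: z => [[z t] k].
rewrite /C /=.
rewrite (perspective_self_polar (B := @swap_pairing R H)); last first.
- exact: separable_self_dual.
- exact: separable_proper.
- by move=> x y; rewrite /swap_pairing (innerC x.1) (innerC x.2) addrC.
- by move=> a x w; rewrite /swap_pairing /= !innerZl mulrDr.
- by move=> x y w; rewrite /swap_pairing /= !innerDl addrACA.
case: z => x v; split.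
  move=> h _ [[[[x' v'] t'] k'] /h] + <-.
  rewrite /cone_swap /= cone_space_innerE /swap_pairing /=.
  rewrite (innerC x) (innerC v); lra.
move=> h [x' v'] t' k' hz; have := h (v', x', k', t').
have Cz : C (x', v', t', k') by exact: hz.
move=> /(_ (ex_intro2 _ _ _ Cz erefl)).
rewrite cone_space_innerE /swap_pairing /= (innerC x) (innerC v); lra.
Qed.

Lemma perspective_coneE : C = polar (@cone_swap R H @` C).
Proof. by apply/seteqP; split=> z /perspective_coneP. Qed.

Lemma perspective_cone_swap_le z w : C z -> C w -> inner (cone_swap z) w <= 0.
Proof. by move=> Cz /perspective_coneP; apply; exists z. Qed.

Lemma inner_cone_swap_diag (x v : H) (t k : R) :
  inner (cone_swap ((x, v, t, k) : E)) (x, v, t, k) = 2 * (inner x v + t * k).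
Proof. by rewrite /cone_swap /= cone_space_innerE (innerC v); ring. Qed.

(** For q = (x, p - x, t, r - t) the residual is the swap of q: it is orthogonal to q by hypothesis
    and nonpositive on C by self-polarity. *)
Lemma perspective_cone_proj (p x : H) (r t : R) :
  C (x, p - x, t, r - t) -> inner x (p - x) + t * (r - t) = 0 ->
  is_metric_proj C (p, p, r, r) (x, p - x, t, r - t).
Proof.
move=> Cq q0; split=> // z Cz.
have -> : ((p, p, r, r) : E) - (x, p - x, t, r - t) =
    cone_swap (x, p - x, t, r - t).
  by congr (_, _, _, _); rewrite /= subKr.
rewrite innerBr inner_cone_swap_diag q0 mulr0 subr0.
exact: perspective_cone_swap_le.
Qed.

(* The swap fixes (p, p, r, r) and maps C onto its polar cone, so it exchanges
   the two components of the Moreau decomposition of (p, p, r, r). *)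
Lemma perspective_cone_proj_exists (p : H) (r : R) : exists x t,
  C (x, p - x, t, r - t) /\ inner x (p - x) + t * (r - t) = 0.
Proof.
set w : E := (p, p, r, r).
have [|||q [Cq hq]] := @metric_proj_exists _ _ C w (@cone_space_complete R H).
- by exists 0; rewrite perspective_coneE; exact: polar0.
- move=> x y t /andP[t0 t1] Cx Cy; rewrite perspective_coneE in Cx Cy *.
  by apply: polar_add; apply: polar_scale => //; lra.
- move=> l h; rewrite perspective_coneE; apply: polar_inner_closed => e /h.
  by rewrite {1}perspective_coneE.
have C2 a : 0 <= a -> C (a *: q).
  by move=> a0; rewrite perspective_coneE; apply: polar_scale => //; rewrite -perspective_coneE.
have hq0 : inner (w - q) q = 0.
  have := hq _ (C2 2 ltac:(lra)); have := hq _ (C2 0 (lexx _)).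
  by rewrite !innerBr !innerZr; lra.
have hqz z : C z -> inner (w - q) z <= 0.
  by move=> /hq; rewrite innerBr hq0 subr0.
have swapK z : cone_swap (cone_swap z) = z :> E by case: z => [[[? ?] ?] ?].
(* The swapped residual is again a projection of w onto C; uniqueness gives q = q', which reads v =
   p - x and k = r - t. *)
set q' := cone_swap (w - q).
have Cq' : C q'.
  rewrite perspective_coneE => _ [z Cz <-].
  by rewrite inner_cone_swap innerC; exact: hqz.
have hq' : is_metric_proj C w q'.
  split=> // z Cz.
  have -> : w - q' = cone_swap q.
    rewrite /q' /w; case: (q) => [[[a b] c] d].
    by congr (_, _, _, _); rewrite /= subKr.
  rewrite innerBr inner_cone_swap (innerC q) hq0 subr0.
  exact: perspective_cone_swap_le.
have qq' : q = q' by exact: (@is_metric_proj_unique _ _ C w).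
case: q => [[[x v] t] k] in Cq hq C2 hq0 hqz q' Cq' hq' qq' *.
move: qq'; rewrite /q' /w /cone_swap /= => -[xv vx tk kt].
exists x, t; rewrite -vx -kt; split=> //.
have := hq0; have -> : w - (x, v, t, k) = cone_swap (x, v, t, k).
  by rewrite /cone_swap /=; congr (_, _, _, _) => /=.
rewrite inner_cone_swap_diag; lra.
Qed.

(** Orthogonality is the second equation of the system. Under it, the bound (t - r) / t in the
    membership condition equals <x / t, (p - x) / t>, so membership is Fenchel-Young equality, and
    [ProxP] turns it into the first equation. *)
Lemma perspective_cone_systemP (p x : H) (r t : R) : 0 < t ->
  (x = t *: Prox f (t^-1 *: p) /\ t - r = inner x (p - x) / t) <->
  (C (x, p - x, t, r - t) /\ inner x (p - x) + t * (r - t) = 0).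
Proof.
move=> t0; have tN0 : t != 0 by rewrite gt_eqF.
have -> : (t - r = inner x (p - x) / t) <->
    (inner x (p - x) + t * (r - t) = 0).
  split=> [h|h].
    have : (t - r) * t = inner x (p - x) by rewrite h divfK.
    lra.
  have -> : inner x (p - x) = (t - r) * t by lra.
  by rewrite mulfK.
have -> : (x = t *: Prox f (t^-1 *: p)) <-> Prox f (t^-1 *: p) = t^-1 *: x.
  by split=> ->; rewrite scalerA ?mulVf ?divff ?scale1r.
have -> : C (x, p - x, t, r - t) <->
   (primal_dual (t^-1 *: x, t^-1 *: (p - x)) <= (- (r - t) / t)%:E)%E.
  exact: perspective_pos.
rewrite -(ProxP fG) -scalerBr innerZl innerZr.
split=> -[h1 h2]; split=> //; move: h1; rewrite /primal_dual /=.
  congr (_ <= _%:E)%E.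
  have -> : inner x (p - x) = (t - r) * t by lra.
  by field.
congr (_ <= _%:E)%E.
have -> : inner x (p - x) = (t - r) * t by lra.
by field.
Qed.

(** * Recession functions, recession cones and the case tau = 0 *)

Lemma recession_fP (w : H) (c : R) : (recession f w <= c%:E)%E <->
  forall w' s, (fenchel_conj f w' <= s%:E)%E -> inner w w' <= c.
Proof. by apply: recession_leP => //; exact: innerDl. Qed.

Lemma recession_kP (w : H) (c : R) : (recession (fenchel_conj f) w <= c%:E)%E <->
  forall w' s, (f w' <= s%:E)%E -> inner w w' <= c.
Proof. by apply: recession_leP => //; exact: innerDl. Qed.

Lemma recession_separable_cone (p x : H) (r : R) :
  C (x, p - x, 0, r) <->
  (recession f x + recession (fenchel_conj f) (p - x)%R <= (- r)%:E)%E.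
Proof.
rewrite /C /= perspective_zero.
exact: (recession_separable fproper kproper fk kf).
Qed.

Lemma recession_gtNy x : (-oo < recession f x)%E.
Proof.
have [_ [u ku]] := kproper; have [b kb] := ereal_finE (kN u) ku.
case E : (recession f x) => [s| |]//; first by rewrite ltNyr.
exfalso; have : (recession f x <= (inner x u - 1)%:E)%E by rewrite E leNye.
by move=> /recession_fP/(_ u b); rewrite kb lexx => /(_ isT); lra.
Qed.

Lemma recession_conj_gtNy u : (-oo < recession (fenchel_conj f) u)%E.
Proof.
have [_ [x fx]] := fproper; have [b fb] := ereal_finE (fN x) fx.
case E : (recession (fenchel_conj f) u) => [s| |]//; first by rewrite ltNyr.
exfalso; have : (recession (fenchel_conj f) u <= (inner u x - 1)%:E)%E by rewrite E leNye.
by move=> /recession_kP/(_ x b); rewrite fb lexx => /(_ isT); lra.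
Qed.

Lemma recession_edom_scale x t : 0 < t ->
  edom (recession f) x -> edom (recession f) (t *: x).
Proof.
move=> t0 /(ereal_finE (recession_gtNy x))[a xa].
have ra : (recession f x <= a%:E)%E by rewrite xa.
apply: (@le_lt_trans _ _ (t * a)%:E); last exact: ltry.
apply/recession_fP => w s kw; rewrite innerZl ler_pM2l//.
exact: (proj1 (recession_fP _ _) ra _ _ kw).
Qed.

(** Adding x maps the domain of f into itself as soon as (rec f)(x) is finite; translation being
    continuous, this passes to the closure. *)
Lemma recession_edom_sub :
  edom (recession f) `<=` recession_cone (closure (edom f)).
Proof.
move=> x /(ereal_finE (recession_gtNy x))[a xa] y yf.
have ra : (recession f x <= a%:E)%E by rewrite xa.
have addc : {for y, continuous (fun z : H => x + z)}.
  by apply: cvgD; [exact: cvg_cst|exact: cvg_id].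
move=> U Uxy; have /yf[z [zf zU]] := addc U Uxy; exists (x + z); split=> //.
have [b zb] := ereal_finE (fN z) zf.
have := @recession_iter _ _ f z x b a 1 fN ra.
rewrite zb lexx mulr1n addrC => /(_ isT) /le_lt_trans; apply; exact: ltry.
Qed.

Lemma recession_conj_closure u b x :
  (recession (fenchel_conj f) u <= b%:E)%E -> closure (edom f) x -> inner u x <= b.
Proof.
move=> ub; have cl : closed [set y : H | inner y u <= b].
  apply: (@preimage_closed H R (fun y => inner y u) [set c | c <= b]).
    by move=> y _; exact: inner_continuous.
  exact: closed_le.
move=> xf; rewrite innerC; suff : closure [set y : H | inner y u <= b] x.
  by rewrite -(proj1 (closure_id _) cl).
move: x xf; apply: closureS => y /(ereal_finE (fN y))[c yc] /=; rewrite innerC.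
by apply: (proj1 (recession_kP _ _) ub y c); rewrite yc.
Qed.

(** The points x0 + n x remain in the closed domain, where <u, .> is bounded by b, so its slope
    along x cannot be positive. *)
Lemma recession_conj_recession_cone u b x :
  (recession (fenchel_conj f) u <= b%:E)%E ->
  recession_cone (closure (edom f)) x -> inner u x <= 0.
Proof.
move=> ub xf; have [_ [x0 fx0]] := fproper.
have iter n : closure (edom f) (x *+ n + x0).
  elim: n => [|n IH]; first by rewrite mulr0n add0r; exact: subset_closure.
  by rewrite mulrS -addrA; exact: xf.
apply: (@archi_le0 _ _ (b - inner u x0)) => n.
have := recession_conj_closure ub (iter n).
by rewrite innerDr -scaler_nat innerZr; lra.
Qed.

(* When tau = 0 the Moreau decomposition p = x + (p - x) is orthogonal with
   x in dom (rec f) and p - x in dom (rec f* ), which makes x the projection onto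
   both cones at once. *)
Lemma degenerate_metric_proj (p x : H) (r : R) :
  (recession f x + recession (fenchel_conj f) (p - x)%R <= (- r)%:E)%E ->
  inner x (p - x) = 0 ->
  metric_proj (recession_cone (closure (edom f))) p = x /\
  metric_proj (closure (edom (recession f))) p = x.
Proof.
move=> deg x0.
have [a [b [xa xb _]]] := proj1 (adde_le_finP _
  (recession_gtNy x) (recession_conj_gtNy (p - x))) deg.
have xdom : edom (recession f) x by apply: le_lt_trans xa _; rewrite ltry.
have opt z : recession_cone (closure (edom f)) z -> inner (p - x) (z - x) <= 0.
  move=> /(recession_conj_recession_cone xb).
  by rewrite innerBr (innerC (p - x) x) x0 subr0.
split; apply: metric_projE; split.
- exact: recession_edom_sub.
- by [].
- exact: subset_closure.
move=> z zf; have cl : closed [set y : H | inner y (p - x) <= inner x (p - x)].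
  apply: (@preimage_closed H R (fun y => inner y (p - x)) [set c | c <= _]).
    by move=> y _; exact: inner_continuous.
  exact: closed_le.
rewrite innerC innerBl subr_le0.
suff : closure [set y : H | inner y (p - x) <= inner x (p - x)] z.
  by rewrite -(proj1 (closure_id _) cl).
move: z zf; apply: closureS => y /recession_edom_sub/opt /=.
by rewrite innerC innerBl subr_le0.
Qed.

(** Once x lies in dom (rec f), both sets contain the positive ray through x, so [metric_proj_scale]
    applies to either choice. *)
Lemma degenerate_orthogonal (p x : H) : edom (recession f) x ->
  x = metric_proj (recession_cone (closure (edom f))) p \/
  x = metric_proj (closure (edom (recession f))) p ->
  inner x (p - x) = 0.
Proof.
move=> xdom [] xE; rewrite {}xE in xdom *;
  apply: metric_proj_scale => t t0 _.
  exact/recession_edom_sub/recession_edom_scale.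
exact/subset_closure/recession_edom_scale.
Qed.

Lemma perspective_cone_metric_proj (p : H) (r : R) (xh : H) :
  xh = metric_proj (recession_cone (closure (edom f))) p \/
  xh = metric_proj (closure (edom (recession f))) p ->
  let degenerate := (recession f xh + recession (fenchel_conj f) (p - xh)%R
    <= (- r)%:E)%E in
  let system (s : H * R) :=
    [/\ 0 < s.2, s.1 = s.2 *: Prox f (s.2^-1 *: p) &
        s.2 - r = inner s.1 (p - s.1) / s.2] in
  (degenerate -> is_metric_proj C (p, p, r, r) (xh, p - xh, 0, r - 0)) /\
  (~~ degenerate -> exists s : H * R, unique system s /\
    is_metric_proj C (p, p, r, r) (s.1, p - s.1, s.2, r - s.2)).
Proof.
move=> hxh degenerate system; split.
  move=> deg; apply: perspective_cone_proj.
    by rewrite subr0; apply/recession_separable_cone.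
  rewrite mul0r addr0; apply: degenerate_orthogonal hxh.
  have [a [b [xa _ _]]] := proj1 (adde_le_finP _
    (recession_gtNy xh) (recession_conj_gtNy (p - xh))) deg.
  by apply: le_lt_trans xa _; rewrite ltry.
move=> ndeg; have [x [t [Cq q0]]] := perspective_cone_proj_exists p r.
have t0 : 0 < t.
  (* If t = 0, then x is both projections of p, hence equals [xh], and membership in the cone is the
     excluded inequality. *)
  have := perspective_le_ge0 Cq; rewrite le_eqVlt => /predU1P[t0|//].
  move: Cq q0 ndeg; rewrite -t0 subr0 mul0r addr0 => /recession_separable_cone deg q0.
  have [h1 h2] := degenerate_metric_proj deg q0.
  have -> : degenerate by rewrite /degenerate; case: hxh => ->; rewrite ?h1 ?h2.
  by [].
exists (x, t); split; last exact: perspective_cone_proj.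
split.
  by have [] := proj2 (perspective_cone_systemP p x r t0) (conj Cq q0).
(* Every solution of the system yields a projection of the same point, so uniqueness of the
   projection gives uniqueness of the solution. *)
move=> [x' t'] [/= t'0 h1 h2].
have [Cq' q'0] := proj1 (perspective_cone_systemP p x' r t'0) (conj h1 h2).
have := is_metric_proj_unique (perspective_cone_proj Cq q0)
  (perspective_cone_proj Cq' q'0).
by case=> -> _ ->.
Qed.

End perspective_cone.

(** * Transfer to the cone of G, and the theorem *)

Lemma perspective_flip (R : realType) (H : lmodType R) (F : H * H -> \bar R)
    (x v : H) (t : R) :
  perspective (fun z => F (z.1, - z.2)) (x, v, t) = perspective F (x, - v, t).
Proof.
rewrite /perspective /=; case: ifP => // _; first by congr (_ * F (_, _))%E; rewrite /= scalerN.
case: ifP => // _; rewrite /recession; congr ereal_sup.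
apply/seteqP; split=> _ [[a b] /= ab <-]; exists (a, - b) => //=.
- by rewrite opprD.
- by rewrite /edom /= opprK.
- by rewrite opprD !opprK.
Qed.

Theorem mainTheorem4 (R : realType) (H : hilbertType R) (f g : H -> \bar R)
  (hf : Gamma0 f) (hg : Gamma0 g)
  (hfg : ereal_inf (range (fun x : H => f x + g x)%E) =
         ereal_sup (range (fun nu : H =>
           - fenchel_conj f nu - fenchel_conj g (- nu)%R)%E)) :
  let F : H * H -> \bar R := (fun z => f z.1 + fenchel_conj f z.2)%E in
  let G : H * H -> \bar R := (fun z => g z.1 + fenchel_conj g (- z.2)%R)%E in
  let setF : set (H * H * R * R) :=
    [set z | (perspective F z.1 <= (- z.2)%:E)%E] in
  let setG : set (H * H * R * R) :=
    [set z | (perspective G z.1 <= z.2%:E)%E] in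
  [/\ [/\ setF !=set0, closed setF, convex_set setF & is_cone setF],
      [/\ setG !=set0, closed setG, convex_set setG & is_cone setG],
      (forall (p : H) (r : R) (xh : H),
        xh = metric_proj (recession_cone (closure (edom f))) p \/
        xh = metric_proj (closure (edom (recession f))) p ->
        let degenerate :=
          (recession f xh + recession (fenchel_conj f) (p - xh)%R
            <= (- r)%:E)%E in
        let system (s : H * R) :=
          [/\ 0 < s.2, s.1 = s.2 *: Prox f (s.2^-1 *: p) &
              s.2 - r = inner s.1 (p - s.1) / s.2] in
        (degenerate -> metric_proj setF (p, p, r, r) = (xh, p - xh, 0, r - 0)) /\
        (~~ degenerate -> exists s : H * R, unique system s /\
          metric_proj setF (p, p, r, r) = (s.1, p - s.1, s.2, r - s.2))) &
      (forall (p : H) (r : R) (xb : H),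
        xb = metric_proj (recession_cone (closure (edom g))) p \/
        xb = metric_proj (closure (edom (recession g))) p ->
        let degenerate :=
          (recession g xb + recession (fenchel_conj g) (p - xb)%R
            <= (- r)%:E)%E in
        let system (s : H * R) :=
          [/\ 0 < s.2, s.1 = s.2 *: Prox g (s.2^-1 *: p) &
              s.2 - r = inner s.1 (p - s.1) / s.2] in
        (degenerate ->
          metric_proj setG (p, - p, r, - r) = (xb, xb - p, 0, 0 - r)) /\
        (~~ degenerate -> exists s : H * R, unique system s /\
          metric_proj setG (p, - p, r, - r) = (s.1, s.1 - p, s.2, s.2 - r)))].
Proof.
move=> F G setF setG.
have setFE : setF = perspective_cone f by [].
pose C := perspective_cone g.
have setGC z : setG z <-> C (cone_flip z).
  case: z => [[[x v] t] k].
  by rewrite /setG /C /perspective_cone /cone_flip /= opprK -perspective_flip.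
(* Since the flip is self-adjoint, the flipped cone is again a polar, which yields nonemptiness,
   closedness, convexity and the cone property at once. *)
have setGE : setG = polar (@cone_flip R H @` (@cone_swap R H @` C)).
  apply/seteqP; split=> z.
    move=> /setGC/(perspective_coneP hg) h _ [w Cw <-].
    by rewrite inner_cone_flip; exact: h.
  move=> h; apply/setGC/(perspective_coneP hg) => w Cw.
  by rewrite -inner_cone_flip; apply: h; exists w.
split.
- rewrite setFE (perspective_coneE hf); split.
  + by exists 0; exact: polar0.
  + exact: polar_closed.
  + exact: polar_convex.
  + exact: polar_cone.
- rewrite setGE; split.
  + by exists 0; exact: polar0.
  + exact: polar_closed.
  + exact: polar_convex.
  + exact: polar_cone.
- move=> p r xh /(perspective_cone_metric_proj hf r)[h1 h2]; split.
    by move=> /h1/metric_projE.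
  by move=> /h2[s [us /metric_projE]]; exists s.
move=> p r xb /(perspective_cone_metric_proj hg r)[h1 h2].
(* It is used at w = (p, p, r, r), whose flip is (p, - p, r, - r). *)
have projG w q : is_metric_proj C w q -> metric_proj setG (cone_flip w) = cone_flip q.
  by move=> /(is_metric_proj_flip setGC)/metric_projE.
split.
  by move=> /h1/projG; rewrite /cone_flip /= !opprB.
by move=> /h2[s [us /projG]]; rewrite /cone_flip /= !opprB; exists s.
Qed.
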